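(* Let $t\in\mathbb{R}$, $\eta\in\mathbb{R}$, $\lambda>-1/2$, $b=\lambda+i\eta$, and let $\Phi_n$ be the monic orthogonal polynomials on the unit circle with respect to the weight function $$w(\theta)=e^{t\cos(\theta)}e^{-\eta\theta}[\sin^2(\theta/2)]^{\lambda},\qquad 0\le\theta\le2\pi.$$ Put $$\mathfrak{s}_{n,n}=-(\overline b+n)+(t/2)(1+\alpha_n\overline{\alpha}_{n-1}),\qquad f_n=(1-\mathfrak{s}_{n,n})\alpha_n+(t/2)(1-|\alpha_n|^2)\alpha_{n+1},$$ $$\gamma_n=(t/2)(\mathfrak{s}_{n,n}+\overline{\mathfrak{s}}_{n,n}\overline{\alpha}_n\alpha_{n-1}+\overline{\alpha}_nf_n+\alpha_{n-1}\overline{f}_n),$$ $$U_n(z)=[n-(t/2)\overline{\alpha}_n\alpha_{n-1}]z^2+\mathfrak{s}_{n,n}z-t/2,$$ $$V_n(z)=-(t/2)\overline{\alpha}_nz^2-[(1-\overline{\mathfrak{s}}_{n,n})\overline{\alpha}_n+(t/2)(1-|\alpha_n|^2)\overline{\alpha}_{n+1}]z-(t/2)\overline{\alpha}_{n-1}.$$ Then, for $n\ge1$, $$z^2(z-1)V_n(z)\Phi_n''(z)+p_4(z)\Phi_n'(z)-p_3(z)\Phi_n(z)=0,$$ where $$p_4(z)=V_n(z)[(t/2)z^3+(b+3-n-t/2)z^2+(\overline b+n-2-t/2)z+t/2]+z^2(z-1)(t\overline{\alpha}_nz+\overline{f}_n),$$ $$p_3(z)=V_n(z)\big[(t/2)n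z^2+[n(b+2)+\gamma_n-t\overline{\alpha}_n\alpha_{n-1}]z-(t/2)n+\mathfrak{s}_{n,n}-\overline{\gamma}_n\big]+(t\overline{\alpha}_nz+\overline{f}_n)U_n(z).$$
   Context: The monic orthogonal polynomials $\Phi_n$ ($\deg\Phi_n=n$) are orthogonal for $\langle f,g\rangle=\int_0^{2\pi}f(e^{i\theta})\overline{g(e^{i\theta})}\,w(\theta)\,d\theta$. Verblunsky coefficients: $\alpha_{n-1}=-\overline{\Phi_n(0)}$ for $n\ge1$, and $\alpha_{-1}=-1$. Prime denotes $d/dz$. *)

(* Defs.v *)
From HB Require Import structures.
From mathcomp Require Import all_boot all_order all_algebra.
From mathcomp Require Import complex.
From mathcomp Require Import all_classical all_reals all_analysis.

Set Implicit Arguments.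
Unset Strict Implicit.
Unset Printing Implicit Defensive.

Import Order.TTheory GRing.Theory Num.Theory.
Import numFieldNormedType.Exports.

(* complex_scope is opened first, so that x^* is Num.conj (from ring_scope). *)
Local Open Scope complex_scope.
Local Open Scope classical_set_scope.
Local Open Scope ring_scope.

Definition expi (R : realType) (theta : R) : R[i] := cos theta +i* sin theta.

(* powR 0 lambda is 0 for lambda != 0 and 1 for lambda = 0; for lambda < 0 this
   gives w finite values at theta = 0 and 2 pi, a null set. *)
Definition weight (R : realType) (t eta lambda theta : R) : R :=
  expR (t * cos theta) * expR (- eta * theta)
  * (sin (theta / 2) ^+ 2) `^ lambda.

Definition cintegral (R : realType) (D : set R) (F : R -> R[i]) : R[i] :=
  (\int[lebesgue_measure]_(x in D) complex.Re (F x))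
  +i* (\int[lebesgue_measure]_(x in D) complex.Im (F x)).

Definition circle_dot (R : realType) (w : R -> R) (f g : R[i] -> R[i]) : R[i] :=
  cintegral `[0, 2 * pi]
    (fun theta => f (expi theta) * (g (expi theta))^* * (w theta)%:C).

Definition monic_OPUC (R : realType) (w : R -> R) (Phi : nat -> {poly R[i]}) :
    Prop :=
  (forall n, size (Phi n) = n.+1 /\ Phi n \is monic) /\
  (forall m n, m <> n -> circle_dot w (horner (Phi m)) (horner (Phi n)) = 0).

(* Only the indices k >= -1 are meaningful. *)
Definition verblunsky (R : realType) (Phi : nat -> {poly R[i]}) (k : int) :
    R[i] :=
  match k with
  | Posz m => - ((Phi m.+1).[0])^*
  | Negz _ => -1
  end.


Definition snn (R : realType) (t : R) (b : R[i]) (alpha : int -> R[i])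
    (n : nat) : R[i] :=
  - (b^* + n%:R) + t%:C / 2 * (1 + alpha n * (alpha (n%:Z - 1))^*).

Definition fn (R : realType) (t : R) (b : R[i]) (alpha : int -> R[i])
    (n : nat) : R[i] :=
  (1 - snn t b alpha n) * alpha n
  + t%:C / 2 * (1 - `|alpha n| ^+ 2) * alpha (n%:Z + 1).

Definition gamman (R : realType) (t : R) (b : R[i]) (alpha : int -> R[i])
    (n : nat) : R[i] :=
  let s := snn t b alpha n in
  let f := fn t b alpha n in
  t%:C / 2 * (s + s^* * (alpha n)^* * alpha (n%:Z - 1)
              + (alpha n)^* * f + alpha (n%:Z - 1) * f^*).

Definition Un (R : realType) (t : R) (b : R[i]) (alpha : int -> R[i])
    (n : nat) (z : R[i]) : R[i] :=
  (n%:R - t%:C / 2 * (alpha n)^* * alpha (n%:Z - 1)) * z ^+ 2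
  + snn t b alpha n * z - t%:C / 2.

Definition Vn (R : realType) (t : R) (b : R[i]) (alpha : int -> R[i])
    (n : nat) (z : R[i]) : R[i] :=
  - (t%:C / 2) * (alpha n)^* * z ^+ 2
  - ((1 - (snn t b alpha n)^*) * (alpha n)^*
     + t%:C / 2 * (1 - `|alpha n| ^+ 2) * (alpha (n%:Z + 1))^*) * z
  - t%:C / 2 * (alpha (n%:Z - 1))^*.

Definition p4 (R : realType) (t : R) (b : R[i]) (alpha : int -> R[i])
    (n : nat) (z : R[i]) : R[i] :=
  Vn t b alpha n z
  * (t%:C / 2 * z ^+ 3 + (b + 3 - n%:R - t%:C / 2) * z ^+ 2
     + (b^* + n%:R - 2 - t%:C / 2) * z + t%:C / 2)
  + z ^+ 2 * (z - 1) * (t%:C * (alpha n)^* * z + (fn t b alpha n)^*).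

Definition p3 (R : realType) (t : R) (b : R[i]) (alpha : int -> R[i])
    (n : nat) (z : R[i]) : R[i] :=
  let g := gamman t b alpha n in
  Vn t b alpha n z
  * (t%:C / 2 * n%:R * z ^+ 2
     + (n%:R * (b + 2) + g - t%:C * (alpha n)^* * alpha (n%:Z - 1)) * z
     - t%:C / 2 * n%:R + snn t b alpha n - g^*)
  + (t%:C * (alpha n)^* * z + (fn t b alpha n)^*) * Un t b alpha n z.

(* Main.v *)
Require Import Defs.
From mathcomp Require Import all_boot all_order all_algebra.
From mathcomp Require Import complex.
From mathcomp Require Import all_classical all_reals all_analysis.
From mathcomp Require Import measurable_realfun ring lra zify.

(** Write [b = lambda + i eta] and [T = t/2].  The weight satisfies the Pearson equation
    [(z - 1) w' = i w (T (z - 1/z) (z - 1) + b z + conj b)] for [z = e^(i theta)], and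
    [(z - 1) w] vanishes at both ends of the interval because [lambda > -1/2]; integrating the
    derivative of [(z - 1) z^k w] gives a recurrence for the moments of [w].  Testing against
    powers of [z] and using Szego's recurrence, it yields the structure relation
    [z^2 (z - 1) Phi_n' = U_n Phi_n + V_n Phi_n^*], where [Phi_n^*] denotes the reversed
    polynomial.  Conjugating it at [1/conj z] gives a similar relation for the derivative of
    [Phi_n^*].  Differentiating the first relation, multiplying by [V_n] and eliminating [Phi_n^*]
    gives the differential equation times [z (z - 1)].  The only coefficient that does not match
    identically does so because [|U_n(1)| = |V_n(1)|], which holds as [z = 1] is not a zero of
    [Phi_n]. *)

Set Implicit Arguments.
Unset Strict Implicit.
Unset Printing Implicit Defensive.

Import Order.TTheory GRing.Theory Num.Theory.
Import numFieldNormedType.Exports.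

Local Open Scope complex_scope.
Local Open Scope classical_set_scope.
Local Open Scope ring_scope.

(** * Reversed polynomials, conjugates of the coefficients, and polynomial identities *)

Definition reversal (C : numClosedFieldType) (n : nat) (p : {poly C}) : {poly C} :=
  \poly_(i < n.+1) (p`_(n - i))^*.

(* [a], [ap] and [am] stand for alpha_n, alpha_(n+1) and alpha_(n-1), and [T] for t/2. *)
Definition s_coef (C : numClosedFieldType) (T b : C) n (a am : C) : C :=
  - (b^* + n%:R) + T * (1 + a * am^*).

Definition f_coef (C : numClosedFieldType) (T b : C) n (a ap am : C) : C :=
  (1 - s_coef T b n a am) * a + T * (1 - a * a^*) * ap.

Definition g_coef (C : numClosedFieldType) (T s f a am : C) : C :=
  T * (s + s^* * a^* * am + a^* * f + am * f^*).

Lemma conj_s_coef (C : numClosedFieldType) (T b : C) n (a am : C) : T^* = T ->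
  (s_coef T b n a am)^* = - (b + n%:R) + T * (1 + a^* * am).
Proof.
move=> T_real.
by rewrite /s_coef !(rmorphD, rmorphN, rmorphM, rmorph1) /= !conjCK T_real conjC_nat.
Qed.

Lemma conj_g_coef (C : numClosedFieldType) (T s f a am : C) : T^* = T ->
  (g_coef T s f a am)^* = T * (s^* + s * a * am^* + a * f^* + am^* * f).
Proof.
by move=> T_real; rewrite /g_coef !(rmorphD, rmorphM) /= !conjCK T_real.
Qed.

Lemma conj_f_coef (C : numClosedFieldType) (T b : C) n (a ap am : C) : T^* = T ->
  (f_coef T b n a ap am)^* =
  (1 - (s_coef T b n a am)^*) * a^* + T * (1 - a * a^*) * ap^*.
Proof.
move=> T_real; rewrite /f_coef.
rewrite !(rmorphB, rmorphD, rmorphM, rmorph1) /= !conjCK T_real.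
by rewrite [a^* * a]mulrC.
Qed.

(** Used with the shift invariance of the form: once [X] is divided out, orthogonality to [X], ...,
    [X^n] becomes orthogonality to [1], ..., [X^(n-1)], which suffices to annihilate the
    quotient. *)
Lemma factor_X (C : idomainType) n (q : {poly C}) :
  q`_0 = 0 -> (size q <= n.+1)%N -> exists2 r, q = 'X * r & (size r <= n)%N.
Proof.
move=> q0 sq; exists (drop_poly 1 q); last by rewrite size_drop_poly leq_subLR.
rewrite mulrC -['X]expr1 -[LHS](poly_take_drop 1) -[RHS]add0r; congr (_ + _).
by apply/polyP=> i; rewrite coef_take_poly coef0; case: i.
Qed.

Lemma horner_reversal (C : numClosedFieldType) n (p : {poly C}) (z : C) :
  (size p <= n.+1)%N -> z != 0 -> (reversal n p).[z] = z ^+ n * (p.[z^-1^*])^*.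
Proof.
move=> sp z0; rewrite /reversal horner_poly (reindex_inj rev_ord_inj)/=.
rewrite (horner_coef_wide _ sp) rmorph_sum mulr_sumr; apply: eq_bigr => i _.
have ilen : (i <= n)%N by rewrite -ltnS.
rewrite subSS subKn// rmorphM rmorphXn /= conjCK mulrCA; congr (_ * _).
have -> : z ^+ n = z ^+ (n - i) * z ^+ i by rewrite -exprD subnK.
by rewrite -mulrA -exprMn mulfV// expr1n mulr1.
Qed.

Lemma coef_reversal (C : numClosedFieldType) n (p : {poly C}) i :
  (reversal n p)`_i = if (i <= n)%N then (p`_(n - i))^* else 0.
Proof. exact: coef_poly. Qed.

(** The operator [X d/dX] multiplies the coefficient of index [i] by [i = (n + 1) - (n + 1 - i)].
    The nominal degree is a parameter of [reversal], so that the derivative can be reversed at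
    degree [n]. *)
Lemma deriv_reversal (C : numClosedFieldType) n (p : {poly C}) :
  'X * (reversal n.+1 p)^`() = n.+1%:R *: reversal n.+1 p - reversal n p^`().
Proof.
apply/polyP => i; rewrite coefXM coefB coefZ coef_deriv !coef_reversal !coef_deriv.
case: i => [|i]/=; first by rewrite !subn0 rmorphMn /= mulr_natl subrr.
rewrite ltnS subSS; case: (ltngtP i n) => [lt|gt|->].
- rewrite subnSK// rmorphMn /= mulr_natl -mulrnBr; last by lia.
  by congr (_ *+ _); lia.
- by rewrite mul0rn mulr0 subrr.
- by rewrite subnn subr0 mulr_natl.
Qed.

(** The points 2, 3, ... are distinct and avoid 0 and 1, and [size (p - q)] of them are too many
    roots for a nonzero difference. *)
Lemma eq_poly_off01 (C : numFieldType) (p q : {poly C}) :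
  (forall z, z != 0 -> z != 1 -> p.[z] = q.[z]) -> p = q.
Proof.
move=> h; apply/eqP; rewrite -subr_eq0; apply/eqP.
apply: (@roots_geq_poly_eq0 _ _ [seq i.+2%:R | i <- iota 0 (size (p - q))]).
- apply/allP => _ /mapP[i _ ->].
  have i0 : i.+2%:R != 0 :> C by rewrite pnatr_eq0.
  have i1 : i.+2%:R != 1 :> C by rewrite -[1]/(1%:R) eqr_nat.
  by rewrite /root hornerD hornerN (h _ i0 i1) subrr.
- by rewrite map_inj_uniq ?iota_uniq// => i j /eqP; rewrite eqr_nat => /eqP[].
- by rewrite size_map size_iota.
Qed.

(** * Orthogonal polynomials for a definite Toeplitz form *)

Section ToeplitzForm.
Variables (C : numClosedFieldType) (D : {poly C} -> {poly C} -> C).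
Hypothesis D_linear : forall a p q r, D (a *: p + q) r = a * D p r + D q r.
Hypothesis D_conj : forall p q, D q p = (D p q)^*.
Hypothesis D_shift : forall p q, D ('X * p) ('X * q) = D p q.
Hypothesis D_definite : forall p, D p p = 0 -> p = 0.

Lemma form0l q : D 0 q = 0.
Proof.
have := D_linear 1 0 0 q; rewrite scaler0 addr0 mul1r => /eqP.
by rewrite -subr_eq subrr eq_sym => /eqP.
Qed.

Lemma formDl p q r : D (p + q) r = D p r + D q r.
Proof. by have := D_linear 1 p q r; rewrite scale1r mul1r. Qed.

Lemma formZl a p r : D (a *: p) r = a * D p r.
Proof. by have := D_linear a p 0 r; rewrite form0l !addr0. Qed.

Lemma formBl p q r : D (p - q) r = D p r - D q r.
Proof. by rewrite -scaleN1r addrC D_linear mulN1r addrC. Qed.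

Lemma form_suml I (s : seq I) (P : pred I) F r :
  D (\sum_(i <- s | P i) F i) r = \sum_(i <- s | P i) D (F i) r.
Proof. by apply: (big_morph (D^~ r)) => [p q|]; rewrite ?formDl ?form0l. Qed.

Lemma formDr p q r : D p (q + r) = D p q + D p r.
Proof. by rewrite D_conj formDl rmorphD /= -!D_conj. Qed.

Lemma formZr a p r : D p (a *: r) = a^* * D p r.
Proof. by rewrite D_conj formZl rmorphM /= -D_conj. Qed.

Lemma form0r q : D q 0 = 0.
Proof. by rewrite D_conj form0l rmorph0. Qed.

Lemma form_sumr I (s : seq I) (P : pred I) F r :
  D r (\sum_(i <- s | P i) F i) = \sum_(i <- s | P i) D r (F i).
Proof. by apply: (big_morph (D r)) => [p q|]; rewrite ?formDr ?form0r. Qed.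

Lemma form_shiftn k p q : D ('X^k * p) ('X^k * q) = D p q.
Proof. by elim: k => [|k IH]; rewrite ?expr0 ?mul1r// exprS -!mulrA D_shift. Qed.

(** The Toeplitz property: a pairing of monomials depends only on the difference of the exponents.
    The condition is stated with sums to avoid truncated subtraction. *)
Lemma form_monomial i j k l : (i + l = j + k)%N -> D 'X^i 'X^j = D 'X^k 'X^l.
Proof.
move=> e; rewrite -(form_shiftn l 'X^i) -(form_shiftn j 'X^k) -!exprD.
by rewrite [(l + i)%N]addnC e [(l + j)%N]addnC.
Qed.

Lemma sum_coef n (p : {poly C}) : (size p <= n)%N ->
  p = \sum_(i < n) p`_i *: 'X^i.
Proof.
by move=> sp; rewrite -poly_def; apply/polyP=> i; rewrite coef_poly;
   case: ltnP => // ni; rewrite nth_default// (leq_trans sp).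
Qed.

Lemma form_ext p q (r : {poly C}) n : (size r <= n)%N ->
  (forall k, (k < n)%N -> D p 'X^k = D q 'X^k) -> D p r = D q r.
Proof.
move=> sr h; rewrite (sum_coef sr) !form_sumr; apply: eq_bigr => i _.
by rewrite !formZr h.
Qed.

Lemma form_eq0 (p : {poly C}) n : (size p <= n)%N ->
  (forall k, (k < n)%N -> D p 'X^k = 0) -> p = 0.
Proof.
move=> sp h; apply: D_definite; rewrite -(form0l p); apply: (form_ext sp) => k kn.
by rewrite h// form0l.
Qed.

(** On the circle the reversed polynomial is [z^n] times the conjugate of [p], so both sides
    integrate conj [p] against the same power, [a + n - c = v - u]. *)
Lemma form_reversal n (p : {poly C}) a c u v :
  (size p <= n.+1)%N -> (a + n + u = v + c)%N ->
  D ('X^a * reversal n p) 'X^c = (D ('X^u * p) 'X^v)^*.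
Proof.
move=> sp e; rewrite /reversal poly_def (reindex_inj rev_ord_inj)/=.
rewrite [p in RHS](sum_coef sp) !mulr_sumr !form_suml rmorph_sum.
apply: eq_bigr => i _; have ilen : (i <= n)%N by rewrite -ltnS.
rewrite subSS subKn// -!scalerAr !formZl rmorphM /= -D_conj -!exprD; congr (_ * _).
by apply: form_monomial; lia.
Qed.

(** * Orthogonality relations, Szego's recurrence and norms *)

Variable Phi : nat -> {poly C}.
Hypothesis Phi_size : forall n, size (Phi n) = n.+1.
Hypothesis Phi_monic : forall n, Phi n \is monic.
Hypothesis Phi_ortho : forall m n, m <> n -> D (Phi m) (Phi n) = 0.

(** Strong induction on the size of [q]: subtracting the multiple of the monic [Phi m] of the same
    size cancels the leading term. *)
Lemma orthogonal_lower n (q : {poly C}) : (size q <= n)%N -> D (Phi n) q = 0.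
Proof.
have [k] := ubnP (size q); elim: k => // k IH in q *; rewrite ltnS => qk qn.
have [->|q0] := eqVneq q 0; first exact: form0r.
set m := (size q).-1.
have sq : size q = m.+1 by rewrite /m prednK// size_poly_gt0.
have mn : (m < n)%N by rewrite -sq.
rewrite -[q](subrK (lead_coef q *: Phi m)) formDr formZr Phi_ortho; last first.
  by move=> e; rewrite e ltnn in mn.
rewrite mulr0 addr0; apply: IH; last first.
  rewrite (leq_trans _ mn)// -?sq (leq_trans (size_polyD _ _))// size_polyN.
  by rewrite geq_max sq leqnn (leq_trans (size_scale_leq _ _))// Phi_size.
apply: leq_trans qk; rewrite sq ltnS; apply/leq_sizeP => j mj.
rewrite coefB coefZ; have [->|jm] := eqVneq j m.
  rewrite -[X in (Phi m)`_X]/(m.+1.-1) -(Phi_size m) -/(lead_coef (Phi m)).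
  by rewrite (monicP (Phi_monic m)) mulr1 subrr.
have mj' : (m < j)%N by rewrite ltn_neqAle eq_sym jm.
by rewrite !nth_default ?mulr0 ?subr0 ?Phi_size ?sq.
Qed.

Lemma orthogonal_monomial n k : (k < n)%N -> D (Phi n) 'X^k = 0.
Proof. by move=> kn; apply: orthogonal_lower; rewrite size_polyXn. Qed.

Lemma reversal_orthogonal n k : (0 < k <= n)%N -> D (reversal n (Phi n)) 'X^k = 0.
Proof.
move=> /andP[k0 kn]; rewrite -[reversal _ _]mul1r -(expr0 'X).
rewrite (@form_reversal _ _ _ _ 0 (n - k)) ?Phi_size//; last by rewrite add0n addn0 subnK.
by rewrite expr0 mul1r orthogonal_monomial ?conjC0// ltn_subrL k0 (leq_trans k0).
Qed.

Let alpha n : C := - ((Phi n.+1).[0])^*.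

Lemma conj_alpha n : (alpha n)^* = - (Phi n.+1)`_0.
Proof. by rewrite /alpha rmorphN /= conjCK horner_coef0. Qed.

Lemma size_reversal n (p : {poly C}) : (size (reversal n p) <= n.+1)%N.
Proof. exact: size_poly. Qed.

Lemma reversal_coef0 n : (reversal n (Phi n))`_0 = 1.
Proof.
rewrite coef_poly/= subn0.
have /monicP := Phi_monic n; rewrite /lead_coef Phi_size /= => ->; exact: conjC1.
Qed.

Lemma Phi_lead n : (Phi n)`_n = 1.
Proof. by have /monicP := Phi_monic n; rewrite /lead_coef Phi_size. Qed.

(** In the difference of the two sides the leading terms and the constant terms cancel, so it is
    [X r] with [r] of size at most [n]. All three polynomials are orthogonal to [X], ..., [X^n],
    hence [r] is orthogonal to [1], ..., [X^(n-1)] and vanishes. *)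
Lemma Szego_recurrence n :
  Phi n.+1 = 'X * Phi n - (alpha n)^* *: reversal n (Phi n).
Proof.
apply/eqP; rewrite -subr_eq0; set q := _ - _.
have sq : (size q <= n.+1)%N.
  apply/leq_sizeP => j nj; rewrite /q !coefB coefXM coefZ.
  rewrite [(reversal _ _)`_j]nth_default ?(leq_trans (size_reversal _ _))// mulr0 subr0.
  case: j nj => // j; rewrite ltnS leq_eqVlt => /predU1P[<-|nj].
    by rewrite !Phi_lead subrr.
  by rewrite !nth_default ?subrr ?Phi_size.
have q0 : q`_0 = 0.
  by rewrite /q !coefB coefXM coefZ reversal_coef0 conj_alpha/=; ring.
have [r qE sr] := factor_X q0 sq.
rewrite qE (form_eq0 sr) ?mulr0// => k kn.
rewrite -D_shift -qE -exprS /q !formBl formZl reversal_orthogonal ?mulr0//.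
by rewrite orthogonal_monomial// exprS D_shift orthogonal_monomial// !subr0.
Qed.

Definition sqnorm n := D (Phi n) (Phi n).

Lemma sqnorm_real n : (sqnorm n)^* = sqnorm n.
Proof. by rewrite -D_conj. Qed.

Lemma form_lead n : D (Phi n) 'X^n = sqnorm n.
Proof.
rewrite /sqnorm -[X in _ = D _ X](subrK 'X^n) formDr.
rewrite [X in _ = X + _]orthogonal_lower ?add0r//.
apply/leq_sizeP => j; rewrite leq_eqVlt coefB coefXn => /predU1P[<-|nj].
  by rewrite Phi_lead eqxx subrr.
by rewrite nth_default ?Phi_size// gtn_eqF// subr0.
Qed.

Lemma form_reversal1 n : D (reversal n (Phi n)) 1 = sqnorm n.
Proof.
rewrite -[reversal _ _]mul1r -(expr0 'X).
rewrite (@form_reversal _ _ _ _ 0 n) ?Phi_size// ?addn0//.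
by rewrite expr0 mul1r form_lead sqnorm_real.
Qed.

Lemma form_shift1 n : D ('X * Phi n) 1 = (alpha n)^* * sqnorm n.
Proof.
have := Szego_recurrence n => /eqP; rewrite eq_sym subr_eq => /eqP ->.
by rewrite formDl formZl form_reversal1 -(expr0 'X) orthogonal_monomial// add0r.
Qed.

(** Szego's recurrence is paired with [X^(n+1)]; the reversed term contributes through
    [form_shift1]. *)
Lemma sqnormS n : sqnorm n.+1 = sqnorm n * (1 - alpha n * (alpha n)^*).
Proof.
rewrite -form_lead [in LHS]Szego_recurrence formBl formZl exprS D_shift form_lead -exprS.
rewrite -[reversal _ _]mul1r -{1}(expr0 'X).
rewrite (@form_reversal _ _ _ _ 1 0) ?Phi_size ?add0n ?addn1// expr0 expr1.
by rewrite form_shift1 rmorphM /= conjCK sqnorm_real; ring.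
Qed.

(** The last pairing is left unevaluated: in [structure_orthogonal] it cancels against the
    contribution of the leading term of [V]. *)
Lemma form_shift2 n :
  D ('X^2 * Phi n) 1 = (alpha n.+1)^* * (1 - alpha n * (alpha n)^*) * sqnorm n
    + (alpha n)^* * D ('X * reversal n (Phi n)) 1.
Proof.
have := Szego_recurrence n => /eqP; rewrite eq_sym subr_eq => /eqP e.
rewrite expr2 -mulrA e mulrDr -scalerAr formDl formZl form_shift1 sqnormS.
by ring.
Qed.

(* If [Phi n] vanished at a point [z0] of the circle, then [Phi n = (X - z0) q] with [q]
   orthogonal to [Phi n]; since [X q = Phi n + z0 q] and [q] have the same norm, that of [Phi n]
   would vanish. *)
Lemma no_root_circle n (z0 : C) : z0 * z0^* = 1 -> (Phi n).[z0] != 0.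
Proof.
move=> z1; apply/negP => /factor_theorem[q PhiE].
have sq : (size q <= n)%N.
  have [->|q0] := eqVneq q 0; first by rewrite size_poly0.
  by move: (Phi_size n); rewrite PhiE size_Mmonic ?monicXsubC// size_XsubC addn2 => -[->].
have XqE : 'X * q = z0 *: q + Phi n by rewrite PhiE -mul_polyC; ring.
have : sqnorm n = 0.
  have := D_shift q q; rewrite XqE D_linear !formDr !formZr orthogonal_lower//.
  rewrite (D_conj (Phi n) q) orthogonal_lower// -/(sqnorm n) !(mulr0, addr0, add0r, conjC0).
  by rewrite mulrA z1 mul1r => /eqP; rewrite -subr_eq0 addrAC subrr add0r => /eqP.
move=> /D_definite Phi0; by have := Phi_size n; rewrite Phi0 size_poly0.
Qed.

Variables (T b : C).
Hypothesis T_real : T^* = T.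
(* The Pearson equation of the weight, integrated against [p] and the conjugate of [X^j]. *)
Hypothesis D_Pearson : forall p j,
  D ('X * ('X - 1) * p^`()) 'X^j =
  - ((1 - j%:R + b - T) * D ('X * p) 'X^j + (j%:R + b^* - T) * D p 'X^j
     + T * D ('X^2 * p) 'X^j + T * D p 'X^(j.+1)).

(** * The structure relation and the differential equation *)

Section StructureRelation.
Variable n : nat.
Hypothesis n_gt0 : (0 < n)%N.

Let a := alpha n.
Let ap := alpha n.+1.
Let am := alpha n.-1.
Let s := s_coef T b n a am.
Let f := f_coef T b n a ap am.
Let P := Phi n.
Let R := reversal n P.
Let U : {poly C} := (n%:R - T * a^* * am) *: 'X^2 + s *: 'X - T%:P.
Let V : {poly C} := - ((T * a^*) *: 'X^2 + f^* *: 'X + (T * am^*)%:P).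

(** After one shift, the Pearson equation leaves only pairings of [Phi_n] and its reversal with
    monomials, nearly all of them zero. The case [j = 0] dictates the coefficient [f], [j = 1] the
    leading coefficient of [V], and [j = n] the coefficient [s]. *)
Lemma structure_orthogonal j : (j <= n)%N ->
  D ('X^2 * ('X - 1) * P^`() - U * P - V * R) 'X^(j.+1) = 0.
Proof.
move=> jn.
have -> : 'X^2 * ('X - 1) * P^`() - U * P - V * R =
    'X * ('X * ('X - 1) * P^`())
    - ((n%:R - T * a^* * am) *: ('X * ('X * P)) + s *: ('X * P) - T *: P)
    + ((T * a^*) *: ('X * ('X * R)) + f^* *: ('X * R) + (T * am^*) *: R).
  by rewrite /U /V -!mul_polyC; ring.
rewrite formDl !formBl !formDl !formZl exprS !D_shift D_Pearson -exprS.
have x0 : D P 'X^j = if j == n then sqnorm n else 0.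
  by case: eqP => [->|/eqP jn']; rewrite ?form_lead// orthogonal_monomial// ltn_neqAle jn'.
(* The exponent [n + 1] is just outside the range of [reversal_orthogonal]; there the pairing is the
   conjugate of that of [X Phi_n] with [1]. *)
have r0 : D R 'X^(j.+1) = if j == n then a * sqnorm n else 0.
  case: eqP => [->|/eqP jn'].
    rewrite -[R]mul1r -{1}(expr0 'X).
    rewrite (@form_reversal _ _ _ _ 1 0) ?Phi_size ?add0n ?addn1// expr0 expr1.
    by rewrite form_shift1 rmorphM /= conjCK sqnorm_real.
  by rewrite reversal_orthogonal//= ltn_neqAle jn'.
have fc : f^* = (1 - s^*) * a^* + T * (1 - a * a^*) * ap^* by exact: conj_f_coef.
have sc : s^* = - (b + n%:R) + T * (1 + a^* * am) by exact: conj_s_coef.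
rewrite x0 r0; case: j jn x0 r0 => [|[|j]] jn x0 r0.
- have n0 : (0%N == n) = false by rewrite eq_sym gtn_eqF.
  rewrite n0 expr0 form_shift1 form_shift2 form_reversal1 -/a -/P -/R fc sc.
  by rewrite -/ap; ring.
(* Here [j = 1] may coincide with [n], so the contributions of both cases can occur together. *)
- have dX p : D ('X * p) 'X = D p 1 by rewrite -[X in D _ X]mulr1 D_shift.
  rewrite expr1 expr2 -mulrA !dX form_shift1 form_reversal1.
  rewrite -[D P 1]/(D P 'X^0) orthogonal_monomial//.
  rewrite (_ : D R 'X = 0); last by rewrite -['X]expr1 reversal_orthogonal.
  by rewrite -/a /s /s_coef; case: eqP => [<-|_]; ring.
- have e1 p : D ('X * p) 'X^(j.+2) = D p 'X^(j.+1) by rewrite exprS D_shift.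
  have e2 p : D ('X^2 * p) 'X^(j.+2) = D p 'X^j.
    by rewrite -[j.+2]/(2 + j)%N exprD form_shiftn.
  rewrite !e1 e2 ![D R _]reversal_orthogonal; [|lia|lia].
  rewrite [D P 'X^j]orthogonal_monomial; last by lia.
  rewrite [D P 'X^(j.+1)]orthogonal_monomial; last by lia.
  by rewrite /s /s_coef; case: eqP => [<-|_]; ring.
Qed.

(** As for Szego's recurrence: the coefficient of [X^(n+2)] in the difference cancels since that of
    [X^n] in [R] is [- am], and the constant term cancels since [Phi_n(0) = - conj am]. What remains
    is [X r] with [r] of size at most [n + 1] and orthogonal to [1], ..., [X^n]. *)
Lemma structure_relation : 'X^2 * ('X - 1) * P^`() = U * P + V * R.
Proof.
apply/eqP; rewrite -subr_eq0 opprD addrA; set q := _ - _ - _.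
have qE : q = 'X^3 * P^`() - 'X^2 * P^`()
    - ((n%:R - T * a^* * am) *: ('X^2 * P) + s *: ('X^1 * P) - T *: P)
    + ((T * a^*) *: ('X^2 * R) + f^* *: ('X^1 * R) + (T * am^*) *: R).
  by rewrite /q /U /V -!mul_polyC; ring.
have amE : am^* = - P`_0 by rewrite conj_alpha prednK.
have Rn : R`_n = - am.
  by rewrite coef_poly ltnSn subnn -[am]conjCK amE rmorphN /= opprK.
have sq : (size q <= n.+2)%N.
  (* Since [n >= 1], an index [j >= n + 2] is at least 3, and no shift by [X^3] or less reaches
     below the constant term. *)
  apply/leq_sizeP => j nj; have [i jE] : exists i, j = i.+3.
    by exists (j - 3)%N; lia.
  rewrite qE !(coefD, coefN, coefZ, coefXnM, coef_deriv) jE /= subSS !subSS !subn0.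
  have Pz k : (n < k)%N -> P`_k = 0 by move=> nk; rewrite nth_default ?Phi_size.
  have Rz k : (n < k)%N -> R`_k = 0.
    by move=> nk; rewrite nth_default// (leq_trans (size_reversal _ _)).
  rewrite !(Pz i.+2, Pz i.+3, Rz i.+2, Rz i.+3); try by lia.
  have [nE|nE] := eqVneq n i.+1.
    by rewrite -nE Rn Phi_lead nE -mulr_natr; ring.
  by rewrite Pz ?Rz; [|lia|lia]; ring.
have q0 : q`_0 = 0.
  rewrite qE !(coefD, coefN, coefZ, coefXnM) /= reversal_coef0 amE; ring.
have [r qXr sr] := factor_X q0 sq.
rewrite qXr (form_eq0 sr) ?mulr0// => k kn.
by rewrite -D_shift -qXr -exprS structure_orthogonal.
Qed.

(* [z ^+ 2] times the conjugates of [U] and [V] at [1 / z^*]. *)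
Let Us (z : C) := n%:R - T * a * am^* + s^* * z - T * z ^+ 2.
Let Vs (z : C) := - (T * a + f * z + T * am * z ^+ 2).

Lemma U_value z : U.[z] = (n%:R - T * a^* * am) * z ^+ 2 + s * z - T.
Proof. by rewrite /U !(hornerD, hornerN, hornerZ, hornerXn, hornerX, hornerC). Qed.

Lemma V_value z : V.[z] = - (T * a^* * z ^+ 2 + f^* * z + T * am^*).
Proof. by rewrite /V !(hornerD, hornerN, hornerZ, hornerXn, hornerX, hornerC). Qed.

Lemma structure_value (z : C) :
  z ^+ 2 * (z - 1) * P^`().[z] = U.[z] * P.[z] + V.[z] * R.[z].
Proof.
by have := congr1 (fun p => p.[z]) structure_relation; rewrite !hornerE.
Qed.

(** The structure relation at [1 / conj z] is conjugated and multiplied by [z^(n+2)];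
    [deriv_reversal] identifies the conjugated derivative with [n R - z R']. *)
Lemma reversed_structure_value (z : C) : z != 0 ->
  (1 - z) * (n%:R * R.[z] - z * R^`().[z]) = Us z * R.[z] + Vs z * P.[z].
Proof.
move=> z0; have zi : z^-1^* != 0 by rewrite conjC_eq0 invr_eq0.
have nE : n = n.-1.+1 by rewrite prednK.
have RE : R.[z] = z ^+ n * (P.[z^-1^*])^* by rewrite horner_reversal// Phi_size.
have PE : P.[z] = z ^+ n * (R.[z^-1^*])^*.
  have e : (z^-1^*)^-1^* = z by rewrite -fmorphV /= conjCK invrK.
  rewrite [R.[_]]horner_reversal ?Phi_size// e rmorphM rmorphXn /= !conjCK.
  by rewrite mulrA -exprMn mulfV// expr1n mul1r.
have DE : n%:R * R.[z] - z * R^`().[z] = z ^+ n.-1 * ((P^`()).[z^-1^*])^*.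
  rewrite -horner_reversal//; last first.
    by rewrite -nE -ltnS -(Phi_size n) lt_size_deriv// -size_poly_gt0 Phi_size.
  have := congr1 (fun p => p.[z]) (deriv_reversal n.-1 P).
  by rewrite -nE !hornerE -/R => ->; ring.
have conj_quad c2 c1 c0 : z ^+ 2 * (c2 * (z^-1^*) ^+ 2 + c1 * z^-1^* + c0)^*
    = c2^* + c1^* * z + c0^* * z ^+ 2.
  by rewrite !(rmorphD, rmorphM, rmorphXn) /= !conjCK; field.
have conj_c2 x y : (n%:R - T * x^* * y)^* = n%:R - T * x * y^*.
  by rewrite !(rmorphB, rmorphM) /= conjCK T_real conjC_nat.
have UE : z ^+ 2 * (U.[z^-1^*])^* = Us z.
  have TN : (- T)^* = - T by rewrite rmorphN /= T_real.
  by rewrite U_value conj_quad conj_c2 TN /Us; ring.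
have conj_T x : (T * x^*)^* = T * x by rewrite rmorphM /= conjCK T_real.
have VE : z ^+ 2 * (V.[z^-1^*])^* = Vs z.
  have conjN x : (- x)^* = - x^* by rewrite rmorphN.
  rewrite V_value conjN mulrN conj_quad !conj_T conjCK.
  by rewrite /Vs; ring.
rewrite DE -UE -VE RE PE.
have := congr1 (fun x => z ^+ 2 * z ^+ n * x^*) (structure_value z^-1^*).
rewrite !(rmorphB, rmorphD, rmorphM, rmorphXn, rmorph1) /= !conjCK => e.
have zn : z ^+ n = z * z ^+ n.-1 by rewrite -exprS -nE.
have -> : (1 - z) * (z ^+ n.-1 * (P^`().[z^-1^*])^*)
    = z ^+ 2 * z ^+ n * (z^-1 ^+ 2 * (z^-1 - 1) * (P^`().[z^-1^*])^*).
  by rewrite zn; field.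
by rewrite e; ring.
Qed.

(** At [z = 1] the derivatives drop out of both structure relations. They become a homogeneous
    linear system for the values of [P] and [R] at 1, whose determinant must vanish because [P.[1]]
    is nonzero. *)
Lemma structure_unimodular : U.[1] * Us 1 = V.[1] * Vs 1.
Proof.
have o0 : (1 : C) != 0 := oner_neq0 _.
have := structure_value 1; have := reversed_structure_value o0.
rewrite !subrr !(mulr0, mul0r) => /esym e1 /esym e2.
have P0 : P.[1] != 0 by apply: no_root_circle; rewrite conjC1 mulr1.
apply: (mulIf P0).
have : Us 1 * (U.[1] * P.[1] + V.[1] * R.[1]) - V.[1] * (Us 1 * R.[1] + Vs 1 * P.[1]) = 0.
  by rewrite e1 e2 !mulr0 subrr.
by move=> h; apply/eqP; rewrite -subr_eq0 -h; apply/eqP; ring.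
Qed.

Let g := g_coef T s f a am.
Let gc := g^*.

Lemma differential_equation_off01 (z : C) : z != 0 -> z != 1 ->
  z ^+ 2 * (z - 1) * V.[z] * P^`()^`().[z]
  + (V.[z] * (T * z ^+ 3 + (b + 3 - n%:R - T) * z ^+ 2 + (b^* + n%:R - 2 - T) * z + T)
     + z ^+ 2 * (z - 1) * (2 * T * a^* * z + f^*)) * P^`().[z]
  - (V.[z] * (T * n%:R * z ^+ 2 + (n%:R * (b + 2) + g - 2 * T * a^* * am) * z
       - T * n%:R + s - gc) + (2 * T * a^* * z + f^*) * U.[z]) * P.[z] = 0.
Proof.
move=> z0 z1; have sc : s^* = - (b + n%:R) + T * (1 + a^* * am) by exact: conj_s_coef.
have bE : b = - s^* - n%:R + T * (1 + a^* * am) by rewrite sc; ring.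
have bcE : b^* = - s - n%:R + T * (1 + a * am^*) by rewrite /s /s_coef; ring.
pose u := U.[z]; pose v := V.[z].
pose u' := 2 * (n%:R - T * a^* * am) * z + s.
pose v' := - (2 * T * a^* * z + f^*).
(* The three relations to combine: the structure relation, its derivative, and the reversed
   relation. *)
have e1 : z ^+ 2 * (z - 1) * P^`().[z] - u * P.[z] - v * R.[z] = 0.
  by rewrite structure_value; rewrite /u /v; ring.
have e2 : z ^+ 2 * (z - 1) * P^`()^`().[z] + (3 * z ^+ 2 - 2 * z) * P^`().[z]
    - u' * P.[z] - u * P^`().[z] - v' * R.[z] - v * R^`().[z] = 0.
  have := congr1 (fun p => p^`().[z]) structure_relation.
  rewrite /U /V !poly.derivE.
  rewrite !(hornerD, hornerN, hornerM, hornerZ, hornerXn, hornerX, hornerC) -/R.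
  move=> /eqP; rewrite -subr_eq0 => /eqP h.
  by rewrite -[RHS]h /u /v /u' /v' U_value V_value; ring.
have e3 : (1 - z) * (n%:R * R.[z] - z * R^`().[z]) - Us z * R.[z] - Vs z * P.[z] = 0.
  by rewrite reversed_structure_value//; ring.
(* Both sides are quartics in [z] that agree except in degree 2; there the difference is the
   value at [z = 1] of the left-hand side. *)
have K : v * Vs z - (Us z - n%:R * (1 - z)) * u
    = (T * n%:R * z ^+ 2 + (n%:R * b + g) * z - T * n%:R - gc) * (z * (z - 1)).
  transitivity ((T * n%:R * z ^+ 2 + (n%:R * b + g) * z - T * n%:R - gc) * (z * (z - 1))
                + z ^+ 2 * (V.[1] * Vs 1 - U.[1] * Us 1)).
    rewrite /u /v !U_value !V_value /Us /Vs /gc conj_g_coef// /g /g_coef [in n%:R * b]bE; ring.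
  by rewrite structure_unimodular subrr mulr0 addr0.
(* After the elimination and division by [z (z - 1)], [v] times this is the part of the coefficient
   of [P'] that does not contain [v']. *)
have L : 3 * z ^+ 2 - 2 * z - u - z * (Us z - n%:R * (1 - z))
    = T * z ^+ 3 + (b + 3 - n%:R - T) * z ^+ 2 + (b^* + n%:R - 2 - T) * z + T.
  by rewrite bcE bE /u U_value /Us; ring.
have zz1 : z * (z - 1) != 0 by rewrite mulf_neq0// subr_eq0.
apply: (mulfI zz1); rewrite mulr0 -L -/u -/v.
have -> : T * n%:R * z ^+ 2 + (n%:R * (b + 2) + g - 2 * T * a^* * am) * z
    - T * n%:R + s - gc
  = T * n%:R * z ^+ 2 + (n%:R * b + g) * z - T * n%:R - gc + u' by rewrite /u'; ring.
have -> : 2 * T * a^* * z + f^* = - v' by rewrite /v' opprK.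
(* The multiplier [v^2] of the reversed relation cancels [R']; the multiplier of the structure
   relation is then forced by the cancellation of [R]. The term with [K] corrects the coefficient of
   [P]. *)
transitivity (
  z * (z - 1) * v * (z ^+ 2 * (z - 1) * P^`()^`().[z] + (3 * z ^+ 2 - 2 * z) * P^`().[z]
    - u' * P.[z] - u * P^`().[z] - v' * R.[z] - v * R^`().[z])
  + v ^+ 2 * ((1 - z) * (n%:R * R.[z] - z * R^`().[z]) - Us z * R.[z] - Vs z * P.[z])
  + (v * (n%:R * (1 - z) - Us z) - z * (z - 1) * v')
    * (z ^+ 2 * (z - 1) * P^`().[z] - u * P.[z] - v * R.[z])
  + v * P.[z] * (v * Vs z - (Us z - n%:R * (1 - z)) * u
    - (T * n%:R * z ^+ 2 + (n%:R * b + g) * z - T * n%:R - gc) * (z * (z - 1)))); last first.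
  by rewrite e1 e2 e3 K subrr !mulr0 !addr0.
move: (Us z) (Vs z) => us vs; clearbody u v u' v'; ring.
Qed.

(** The left-hand side is a polynomial in [z], so the excluded points 0 and 1 are recovered by
    [eq_poly_off01]. *)
Lemma differential_equation (z : C) :
  let U := (n%:R - T * a^* * am) * z ^+ 2 + s * z - T in
  let V := - (T * a^* * z ^+ 2 + f^* * z + T * am^*) in
  z ^+ 2 * (z - 1) * V * P^`()^`().[z]
  + (V * (T * z ^+ 3 + (b + 3 - n%:R - T) * z ^+ 2 + (b^* + n%:R - 2 - T) * z + T)
     + z ^+ 2 * (z - 1) * (2 * T * a^* * z + f^*)) * P^`().[z]
  - (V * (T * n%:R * z ^+ 2 + (n%:R * (b + 2) + g - 2 * T * a^* * am) * z
       - T * n%:R + s - g^*) + (2 * T * a^* * z + f^*) * U) * P.[z] = 0.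
Proof.
rewrite -U_value -V_value /=.
pose q : {poly C} := 'X^2 * ('X - 1) * V * P^`()^`()
  + (V * (T *: 'X^3 + (b + 3 - n%:R - T) *: 'X^2 + (b^* + n%:R - 2 - T) *: 'X + T%:P)
     + 'X^2 * ('X - 1) * ((2 * T * a^*) *: 'X + (f^*)%:P)) * P^`()
  - (V * ((T * n%:R) *: 'X^2 + (n%:R * (b + 2) + g - 2 * T * a^* * am) *: 'X
       - (T * n%:R)%:P + s%:P - gc%:P) + ((2 * T * a^*) *: 'X + (f^*)%:P) * U) * P.
have q0 : q = 0.
  apply: eq_poly_off01 => x x0 x1; rewrite horner0 -[RHS](differential_equation_off01 x0 x1).
  by rewrite /q !(hornerD, hornerN, hornerM, hornerZ, hornerXn, hornerX, hornerC).
have := congr1 (fun p => p.[z]) q0; rewrite horner0 => h; rewrite -[RHS]h.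
by rewrite /q !(hornerD, hornerN, hornerM, hornerZ, hornerXn, hornerX, hornerC).
Qed.

End StructureRelation.
End ToeplitzForm.

(** * Improper integrals of derivatives *)

Section ImproperIntegral.
Variable R : realType.
Notation mu := (@lebesgue_measure R).
Implicit Types (f F : R -> R) (a b M : R).

(** The function [f] may blow up at the endpoints. Integrability makes its indefinite integral [G]
    continuous on the closed interval, and [G - F] has zero derivative inside, so the mean value
    theorem equates its values at the endpoints. *)
Lemma Rintegral_improper f F a b : a < b ->
  mu.-integrable `[a, b] (EFin \o f) ->
  {in `]a, b[, continuous f} ->
  (forall x, x \in `]a, b[ -> is_derive x 1 F (f x)) ->
  {within `[a, b], continuous F} ->
  \int[mu]_(x in `[a, b]) f x = F b - F a.
Proof.
move=> ab fi fc dF Fc.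
pose G x := \int[mu]_(y in `[a, x]) f y.
have Gc : {within `[a, b], continuous G} by exact: parameterized_integral_continuous (ltW ab) fi.
have dG x : x \in `]a, b[ -> is_derive x 1 G (f x).
  move=> xab; have := xab; rewrite in_itv /= => /andP[ax xb].
  have [Gd GE] := continuous_FTC1_closed xb fi ax (fc _ xab).
  by rewrite -GE derive1E; exact: DeriveDef.
have [c _] := MVT_segment (ltW ab) (fun x xab => is_deriveB (dG x xab) (dF x xab))
  (fun x => cvgB (Gc x) (Fc x)).
rewrite subrr mul0r => /eqP; rewrite subr_eq0 => /eqP.
have Ga : G a = 0 by rewrite /G set_itv1 Rintegral_set1.
rewrite -[LHS]/(G b - F b) -[RHS]/(G a - F a) Ga => e.
by rewrite -[LHS](subrK (F b)) e; ring.
Qed.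

(** On compact subintervals the fundamental theorem of calculus bounds the integral by [2 M]; these
    subintervals exhaust the open one and monotone convergence applies. *)
Lemma integrable_derivative_ge0 f F a b M : a < b ->
  {in `]a, b[, continuous f} ->
  (forall x, x \in `]a, b[ -> is_derive x 1 F (f x)) ->
  (forall x, x \in `]a, b[ -> 0 <= f x) ->
  (forall x, x \in `]a, b[ -> `|F x| <= M) ->
  mu.-integrable `]a, b[ (EFin \o f).
Proof.
move=> ab fc dF f0 FM.
(* The offset 3 keeps every [I n] nondegenerate, of length at least [(b - a) / 3]. *)
pose I n : set R := [set` `[a + (b - a) / n.+3%:R, b - (b - a) / n.+3%:R]].
have en n : 0 < (b - a) / n.+3%:R :> R by rewrite divr_gt0// subr_gt0.
have e3 n : (b - a) / n.+3%:R <= (b - a) / 3 :> R.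
  by rewrite ler_pM2l ?subr_gt0// lef_pV2 ?posrE// ler_nat.
have Isub n : I n `<=` `]a, b[.
  move=> x; rewrite /I /= !in_itv /= => /andP[h1 h2].
  apply/andP; split; first by rewrite (lt_le_trans _ h1)// ltrDl.
  by rewrite (le_lt_trans h2)// ltrBlDr ltrDl.
have Iab n : a + (b - a) / n.+3%:R < b - (b - a) / n.+3%:R.
  by move: (e3 n); move: (_ / n.+3%:R) => e; lra.
have mf : measurable_fun `]a, b[ f.
  apply: open_continuous_measurable_fun; first exact: interval_open.
  by move=> x; rewrite inE => /fc.
have Iint n : (\int[mu]_(x in I n) (f x)%:E <= (M + M)%:E)%E.
  have sub x : x \in `[a + (b - a) / n.+3%:R, b - (b - a) / n.+3%:R] -> x \in `]a, b[.
    by move=> h; apply: (Isub n).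
  have c1 x : x \in `[a + (b - a) / n.+3%:R, b - (b - a) / n.+3%:R] -> {for x, continuous F}.
    move=> /sub/dF[dx _]; exact/differentiable_continuous/derivable1_diffP.
  rewrite (@continuous_FTC2 _ f F)//.
  - rewrite -EFinB lee_fin (le_trans (ler_norm _))// (le_trans (ler_normB _ _))//.
    by apply: lerD; apply: FM; apply: sub; rewrite in_itv /= lexx ltW.
  - by apply: continuous_in_subspaceT => x; rewrite inE => /sub/fc.
  - split.
    + by move=> x /subset_itv_oo_cc/sub/dF[].
    + by apply: cvg_at_right_filter; apply: c1; rewrite in_itv /= lexx ltW.
    + by apply: cvg_at_left_filter; apply: c1; rewrite in_itv /= lexx ltW.
  - by move=> x /subset_itv_oo_cc/sub/dF dx; rewrite derive1E derive_val.
have Ibig : `]a, b[%classic = \bigcup_n I n.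
  apply/seteqP; split; last by move=> x [n _ /Isub].
  move=> x /=; rewrite in_itv /= => /andP[ax xb].
  (* The point [x] lies in [I n] as soon as [(b - a) / (n + 3)] is at most its distance [d] to the
     endpoints. *)
  pose d := Num.min (x - a) (b - x).
  have d0 : 0 < d by rewrite lt_min !subr_gt0 ax xb.
  exists (Num.truncn ((b - a) / d)) => //.
  have : (b - a) / (Num.truncn ((b - a) / d)).+3%:R <= d.
    rewrite ler_pdivrMr// mulrC -ler_pdivrMr//.
    rewrite (le_trans (ltW (truncnS_gt _)))// ler_nat.
    by rewrite ltnS; exact: leqW (leqnSn _).
  rewrite /d le_min /I /= in_itv /= => /andP[h1 h2].
  by rewrite -lerBrDl h1 lerBrDr -lerBrDl h2.
apply/integrableP; split; first exact/measurable_EFinP.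
apply: (@le_lt_trans _ _ (M + M)%:E); last exact: ltry.
have -> : (\int[mu]_(x in `]a, b[) `|(EFin \o f) x| = \int[mu]_(x in `]a, b[) (f x)%:E)%E.
  by apply: eq_integral => x; rewrite inE => /f0 fx; rewrite /= ger0_norm.
rewrite Ibig.
have cv : (\int[mu]_(x in I i) (f x)%:E @[i --> \oo] --> \int[mu]_(x in \bigcup_i I i) (f x)%:E)%E.
  apply: ge0_nondecreasing_set_cvg_integral => //.
  - apply/nondecreasing_seqP => n; rewrite subsetEset; apply: subset_itv.
        by rewrite bnd_simp lerD2l ler_pM2l ?subr_gt0// lef_pV2 ?posrE// ler_nat leqnSn.
    by rewrite bnd_simp lerD2l lerN2 ler_pM2l ?subr_gt0// lef_pV2 ?posrE// ler_nat leqnSn.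
  - by move=> n; exact: measurable_itv.
  - move=> n; apply/measurable_EFinP.
    by apply: measurable_funS mf; [exact: measurable_itv|exact: Isub].
  - by move=> n x /Isub /f0; rewrite lee_fin.
rewrite -(cvg_lim _ cv)//; apply: lime_le; first by apply/cvg_ex; eexists; exact: cv.
by apply: nearW => n; exact: Iint.
Qed.

End ImproperIntegral.

Lemma cvg_powR0 (R : realType) (T : Type) (F : set_system T) {FF : Filter F}
    (f : T -> R) (r : R) : 0 < r -> (\forall x \near F, 0 <= f x) ->
  f @ F --> (0 : R) -> f x `^ r @[x --> F] --> (0 : R).
Proof.
move=> r0 f0 /cvgrPdist_lt cf; apply/cvgrPdist_lt => e e0.
have /cf := powR_gt0 r^-1 e0.
apply: filterS2 f0 => x fx; rewrite !sub0r !normrN !ger0_norm ?powR_ge0// => lt.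
have -> : e = (e `^ r^-1) `^ r by rewrite -powRrM mulVf ?gt_eqF// powRr1// ltW.
by rewrite gt0_ltr_powR// nnegrE powR_ge0.
Qed.

(** * The Pearson equation of the weight *)

Section Weight.
Variables (R : realType) (t eta lambda : R).
Hypothesis lambda_gt : - (1 / 2) < lambda.
Notation mu := (@lebesgue_measure R).
Local Notation w := (weight t eta lambda).
Local Notation y x := (sin (x / 2)).
Local Notation E x := (expR (t * cos x) * expR (- eta * x)).

Lemma pi2_gt0 : 0 < 2 * pi :> R.
Proof. by rewrite mulr_gt0// pi_gt0. Qed.

Lemma sin_half_gt0 (x : R) : x \in `]0, (2 * pi)[ -> 0 < y x.
Proof.
rewrite in_itv /= => /andP[x0 x2]; apply: sin_gt0_pi.
by rewrite divr_gt0// ltr_pdivrMr// mulrC.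
Qed.

Lemma sin_half_ge0 (x : R) : x \in `[0, (2 * pi)] -> 0 <= y x.
Proof.
rewrite in_itv /= => /andP[x0 x2]; apply: sin_ge0_pi.
by rewrite divr_ge0// ler_pdivrMr// mulrC.
Qed.

Lemma weightE (x : R) : x \in `[0, (2 * pi)] -> w x = E x * y x `^ (2 * lambda).
Proof. by move=> /sin_half_ge0 y0; rewrite /weight powRrM powR_mulrn. Qed.

Lemma weight_ge0 (x : R) : 0 <= w x.
Proof. by rewrite /weight !mulr_ge0 ?expR_ge0 ?powR_ge0. Qed.

Lemma weight_gt0 (x : R) : x \in `]0, (2 * pi)[ -> 0 < w x.
Proof.
by move=> /sin_half_gt0 y0; rewrite /weight !mulr_gt0 ?expR_gt0// powR_gt0// exprn_gt0.
Qed.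

Lemma is_derive_sin_half (x : R) : is_derive x 1 (fun x : R => y x) (cos (x / 2) / 2).
Proof. by apply: is_derive_eq; rewrite /GRing.scale /=; field. Qed.

Lemma is_derive_cos_half (x : R) : is_derive x 1 (fun x : R => cos (x / 2)) (- y x / 2).
Proof. by apply: is_derive_eq; rewrite /GRing.scale /=; field. Qed.

Lemma is_derive_E (x : R) : is_derive x 1 (fun x : R => E x) (E x * (- t * sin x - eta)).
Proof. by apply: is_derive_eq; rewrite /GRing.scale /=; ring. Qed.

Lemma is_derive_powR_half (r x : R) : x \in `]0, (2 * pi)[ ->
  is_derive x 1 (fun x : R => y x `^ r) (r * y x `^ (r - 1) * (cos (x / 2) / 2)).
Proof.
move=> /sin_half_gt0 y0.
apply: (is_derive1_comp (f := fun z => z `^ r)); first exact: is_derive1_powR.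
exact: is_derive_sin_half.
Qed.

Lemma derive_continuous_at (f : R -> R) (x d : R) : is_derive x 1 f d -> {for x, continuous f}.
Proof. by move=> [df _]; exact/differentiable_continuous/derivable1_diffP. Qed.

Lemma powR_half_le1 (r x : R) : 0 < r -> y x `^ r <= 1.
Proof.
move=> r0; rewrite /powR; case: ifPn => _; first by rewrite gt_eqF.
by rewrite -expR0 ler_expR pmulr_rle0// ln_le0// sin_le1.
Qed.

Lemma powR_addn n (r z : R) : 0 < z -> z `^ (r + n%:R) = z `^ r * z ^+ n.
Proof. by move=> z0; rewrite powRD ?(gt_eqF z0) ?implybT// powR_mulrn// ltW. Qed.

(* Dominates [(2 lambda + 1) y^(2 lambda)], and has the elementary primitive
   [2 y^(2 lambda + 1) cos (x / 2) + (2 lambda + 2) x]. *)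
Let dom (x : R) := (2 * lambda + 1) * y x `^ (2 * lambda)
  + (2 * lambda + 2) * (1 - y x `^ (2 * lambda + 2)).

(** Differentiating [F] and replacing the squared cosine by one minus the squared sine gives exactly
    [dom]. Both summands of [dom] are nonnegative, and [F] is bounded because [2 lambda + 1 > 0]. *)
Lemma dom_integrable : mu.-integrable `]0, (2 * pi)[ (EFin \o dom).
Proof.
have l2 : 0 < 2 * lambda + 2 by move: lambda_gt; lra.
pose F (x : R) : R := 2 * y x `^ (2 * lambda + 1) * cos (x / 2) + (2 * lambda + 2) * x.
apply: (@integrable_derivative_ge0 _ _ F _ _ (2 + (2 * lambda + 2) * (2 * pi)) pi2_gt0).
- move=> x x02; have d1 := is_derive_powR_half (2 * lambda) x02.
  have d2 := is_derive_powR_half (2 * lambda + 2) x02.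
  exact: derive_continuous_at.
- move=> x x02; have y0 := sin_half_gt0 x02.
  have d1 := is_derive_powR_half (2 * lambda + 1) x02.
  have d2 := is_derive_cos_half x.
  apply: is_derive_eq; rewrite /GRing.scale /= /dom.
  have -> : 2 * lambda + 1 - 1 = 2 * lambda by ring.
  have c2 : cos (x / 2) ^+ 2 = 1 - y x ^+ 2 by rewrite cos2sin2.
  rewrite !(powR_addn 2 _ y0) !(powR_addn 1 _ y0) expr1.
  move: (y x `^ (2 * lambda)) => p.
  transitivity ((2 * lambda + 1) * p * cos (x / 2) ^+ 2 - p * y x ^+ 2 + (2 * lambda + 2)).
    by field.
  by rewrite c2; ring.
- move=> x x02; rewrite addr_ge0// mulr_ge0 ?powR_ge0//; try by move: lambda_gt; lra.
  by rewrite subr_ge0 powR_half_le1.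
- move=> x x02; rewrite (le_trans (ler_normD _ _))// lerD//.
    rewrite !normrM (@ger0_norm _ 2)// (ger0_norm (powR_ge0 _ _)) -mulrA -[leRHS]mulr1.
    rewrite ler_pM2l// mulr_ile1 ?powR_ge0 ?normr_ge0 ?cos_max// powR_half_le1//.
    by move: lambda_gt; lra.
  move: x02; rewrite in_itv /= => /andP[x0 x2].
  by rewrite ger0_norm ?mulr_ge0 ?ler_pM2l ?(ltW x2) ?(ltW x0) ?(ltW l2).
Qed.

Lemma measurable_weight : measurable_fun setT w.
Proof.
apply: measurable_funM.
  apply: continuous_measurable_fun => x.
  exact: derive_continuous_at (is_derive_E x).
apply: (@measurableT_comp _ _ _ _ _ _ (fun z : R => z `^ lambda)) => //.
apply: measurable_funX; apply: continuous_measurable_fun => x.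
exact: derive_continuous_at (is_derive_sin_half x).
Qed.

(** The exponential factors are bounded on the interval and [dom] controls the power of the sine;
    [K] collects the two constants. The endpoints form a null set. *)
Lemma weight_integrable : mu.-integrable `[0, (2 * pi)] (EFin \o w).
Proof.
have oo : mu.-integrable `]0, (2 * pi)[ (EFin \o w).
  pose K := expR (`|t| + `|eta| * (2 * pi)) / (2 * lambda + 1).
  have l1 : 0 < 2 * lambda + 1 by move: lambda_gt; lra.
  have dK : mu.-integrable `]0, (2 * pi)[ (fun x => K%:E * (EFin \o dom) x)%E.
    by apply: integrableZl => //; exact: dom_integrable.
  apply: le_integrable dK => //.
    by apply/measurable_EFinP; apply: measurable_funTS; exact: measurable_weight.
  move=> x x02 /=; have x02' : x \in `[0, (2 * pi)] by exact: subset_itv_oo_cc.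
  rewrite lee_fin (ger0_norm (weight_ge0 x)) weightE//.
  rewrite (le_trans _ (ler_norm _))// /K /dom -expRD.
  have p0 := powR_ge0 (y x) (2 * lambda).
  apply: (@le_trans _ _ (expR (`|t| + `|eta| * (2 * pi)) * y x `^ (2 * lambda))).
    rewrite ler_wpM2r// ler_expR lerD//.
      rewrite (le_trans (ler_norm _))// normrM -[leRHS]mulr1 ler_wpM2l//.
      exact: cos_max.
    rewrite (le_trans (ler_norm _))// normrM normrN ler_wpM2l//.
    by move: x02'; rewrite in_itv /= => /andP[x0 x2]; rewrite ger0_norm.
  rewrite -mulrA ler_pM2l ?expR_gt0// ler_pdivlMl// lerDl mulr_ge0//.
    by move: lambda_gt; lra.
  by rewrite subr_ge0 powR_half_le1//; move: lambda_gt; lra.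
apply/integrableP; split.
  by apply/measurable_EFinP; apply: measurable_funTS; exact: measurable_weight.
rewrite integral_itv_bndoo; last first.
  apply: measurableT_comp => //; apply/measurable_EFinP; apply: measurable_funTS.
  exact: measurable_weight.
by move/integrableP : oo => [].
Qed.

Lemma integrable_continuousM (u : R -> R) : continuous u ->
  mu.-integrable `[0, (2 * pi)] (EFin \o (fun x => u x * w x)).
Proof.
move=> uc.
have /= := @integrableMr _ _ _ mu `[0, (2 * pi)]%classic _ u (EFin \o w).
apply => //.
- by apply: measurable_funTS; exact: continuous_measurable_fun.
- have : bounded_set (u @` `[0, (2 * pi)]).
    apply: compact_bounded; apply: continuous_compact; last exact: segment_compact.
    exact: continuous_subspaceT.
  move=> [M [Mreal Mu]]; exists M; split => // N MN x x02.
  by apply: (Mu N MN); exists x.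
- exact: weight_integrable.
Qed.

Lemma continuous_weight (x : R) : x \in `]0, (2 * pi)[ -> {for x, continuous w}.
Proof.
move=> x02; have y0 := sin_half_gt0 x02.
have y2 : 0 < y x ^+ 2 by rewrite exprn_gt0.
have d1 := is_derive_sin_half x.
have d2 : is_derive x 1 (fun x : R => y x ^+ 2) (2 * y x * (cos (x / 2) / 2)).
  by apply: is_derive_eq; rewrite /GRing.scale /=; ring.
have d3 := @is_derive1_comp _ (fun z => z `^ lambda) (fun x => y x ^+ 2) x _ _
  (is_derive1_powR lambda y2) d2.
exact: derive_continuous_at (is_deriveM (is_derive_E x) d3).
Qed.

(** The integrand is the derivative of [u sin(x/2) w], in which the sine has exponent
    [2 lambda + 1 > 0]. This function is therefore continuous up to the endpoints and vanishes
    there. *)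
Lemma weight_Pearson (u u' : R -> R) :
  (forall x : R, is_derive x 1 u (u' x)) -> continuous u' ->
  \int[mu]_(x in `[0, (2 * pi)])
    ((u' x * y x + u x * ((lambda + 1 / 2) * cos (x / 2) - (t * sin x + eta) * y x)) * w x)
  = 0.
Proof.
move=> du uc'.
pose g (x : R) := u' x * y x + u x * ((lambda + 1 / 2) * cos (x / 2) - (t * sin x + eta) * y x).
have uc : continuous u by move=> x; exact: derive_continuous_at (du x).
have gc : continuous g.
  move=> x; apply: cvgD; apply: cvgM.
  - exact: uc'.
  - exact: derive_continuous_at (is_derive_sin_half x).
  - exact: uc.
  - apply: cvgB; apply: cvgM.
    + exact: cvg_cst.
    + exact: derive_continuous_at (is_derive_cos_half x).
    + apply: cvgD; last exact: cvg_cst.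
      by apply: cvgM; [exact: cvg_cst|exact: continuous_sin].
    + exact: derive_continuous_at (is_derive_sin_half x).
have l1 : 0 < 2 * lambda + 1 by move: lambda_gt; lra.
pose F (x : R) : R := u x * (E x * y x `^ (2 * lambda + 1)).
rewrite -[LHS]/(\int[mu]_(x in `[0, (2 * pi)]) (g x * w x)).
transitivity (F (2 * pi) - F 0); last first.
  rewrite /F mul0r sin0 (_ : 2 * pi / 2 = pi :> R) ?sinpi ?powR0 ?gt_eqF ?mulr0 ?subrr//.
  by field.
apply: Rintegral_improper.
- exact: pi2_gt0.
- exact: integrable_continuousM.
- by move=> x x02; apply: cvgM; [exact: gc|exact: continuous_weight].
- move=> x x02; have x02' : x \in `[0, (2 * pi)] by exact: subset_itv_oo_cc.
  have d0 := du x; have d1 := is_derive_E x.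
  have d2 := is_derive_powR_half (2 * lambda + 1) x02.
  rewrite /F; apply: is_derive_eq; rewrite /GRing.scale /= /g weightE//.
  have -> : 2 * lambda + 1 - 1 = 2 * lambda by ring.
  rewrite (powR_addn 1 _ (sin_half_gt0 x02)) expr1.
  by field.
- apply/continuous_within_itvP; first exact: pi2_gt0.
  have ps0 : (fun x : R => y x `^ (2 * lambda + 1)) @ 0^'+ --> (0 : R).
    apply: cvg_powR0 => //.
      near=> x; apply: sin_half_ge0; rewrite in_itv /=; apply/andP; split; near: x.
        exact: nbhs_right_ge.
      exact: nbhs_right_le pi2_gt0.
    have := derive_continuous_at (is_derive_sin_half (0 : R)).
    by rewrite /prop_for /continuous_at /= mul0r sin0 => /cvg_at_right_filter.
  have ps1 : (fun x : R => y x `^ (2 * lambda + 1)) @ (2 * pi)^'- --> (0 : R).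
    apply: cvg_powR0 => //.
      near=> x; apply: sin_half_ge0; rewrite in_itv /=; apply/andP; split; near: x.
        exact: nbhs_left_ge pi2_gt0.
      exact: nbhs_left_le.
    have := derive_continuous_at (is_derive_sin_half (2 * pi : R)).
    rewrite /prop_for /continuous_at /= (_ : 2 * pi / 2 = pi :> R); last by field.
    by rewrite sinpi => /cvg_at_left_filter.
  split.
  + move=> x x02; apply: cvgM; first exact: uc.
    apply: cvgM; first exact: derive_continuous_at (is_derive_E x).
    exact: derive_continuous_at (is_derive_powR_half _ x02).
  + rewrite /F mul0r sin0 powR0 ?gt_eqF//; apply: cvgM.
      by apply: cvg_at_right_filter; exact: uc.
    apply: cvgM; last exact: ps0.
    by apply: cvg_at_right_filter; exact: derive_continuous_at (is_derive_E 0).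
  + rewrite /F (_ : 2 * pi / 2 = pi :> R); last by field.
    rewrite sinpi powR0 ?gt_eqF//; apply: cvgM.
      by apply: cvg_at_left_filter; exact: uc.
    apply: cvgM; last exact: ps1.
    by apply: cvg_at_left_filter; exact: derive_continuous_at (is_derive_E _).
Unshelve. all: by end_near.
Qed.

End Weight.

(** * Complex-valued integrals *)

Section ComplexValued.
Variable R : realType.
Notation mu := (@lebesgue_measure R).
Implicit Types (F G h : R -> R[i]).
Variable i : interval R.
Local Notation A := [set` i].

Lemma ReM (a b : R[i]) :
  complex.Re (a * b) = complex.Re a * complex.Re b - complex.Im a * complex.Im b.
Proof. by case: a b => ? ? []. Qed.

Lemma ImM (a b : R[i]) :
  complex.Im (a * b) = complex.Re a * complex.Im b + complex.Im a * complex.Re b.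
Proof. by case: a b => ? ? []. Qed.

Lemma ReD (a b : R[i]) : complex.Re (a + b) = complex.Re a + complex.Re b.
Proof. by case: a b => ? ? []. Qed.

Lemma ImD (a b : R[i]) : complex.Im (a + b) = complex.Im a + complex.Im b.
Proof. by case: a b => ? ? []. Qed.

Lemma ReN (a : R[i]) : complex.Re (- a) = - complex.Re a.
Proof. by case: a. Qed.

Lemma ImN (a : R[i]) : complex.Im (- a) = - complex.Im a.
Proof. by case: a. Qed.

Lemma Re_conj (a : R[i]) : complex.Re a^* = complex.Re a.
Proof. by case: a. Qed.

Lemma Im_conj (a : R[i]) : complex.Im a^* = - complex.Im a.
Proof. by case: a. Qed.

Lemma complex_eq (a b : R[i]) :
  complex.Re a = complex.Re b -> complex.Im a = complex.Im b -> a = b.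
Proof. by case: a b => ? ? [? ?] /= -> ->. Qed.

Definition cintegrable F :=
  mu.-integrable A (EFin \o (fun x => complex.Re (F x))) /\
  mu.-integrable A (EFin \o (fun x => complex.Im (F x))).

Lemma eq_cintegral F G : {in A, F =1 G} -> cintegral A F = cintegral A G.
Proof.
by move=> FG; rewrite /cintegral; congr (_ +i* _); apply: eq_Rintegral => x /FG ->.
Qed.

Lemma cintegralD F G : cintegrable F -> cintegrable G ->
  cintegral A (fun x => F x + G x) = cintegral A F + cintegral A G.
Proof.
move=> [rF iF] [rG iG]; apply: complex_eq; rewrite ?ReD ?ImD /= -RintegralD//.
  by apply: eq_Rintegral => x _; rewrite ReD.
by apply: eq_Rintegral => x _; rewrite ImD.
Qed.

Lemma cintegralZ (k : R[i]) F : cintegrable F ->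
  cintegral A (fun x => k * F x) = k * cintegral A F.
Proof.
move=> [rF iF]; case: k => a b.
have Z (c : R) f : mu.-integrable A (EFin \o f) ->
    mu.-integrable A (EFin \o (fun x => c * f x)).
  by move=> fi; apply: eq_integrable (integrableZl _ c fi).
apply: complex_eq; rewrite ?ReM ?ImM /= -!RintegralZl//.
  rewrite -RintegralB//; try exact: Z.
  by apply: eq_Rintegral => x _; rewrite ReM.
rewrite -RintegralD//; try exact: Z.
by apply: eq_Rintegral => x _; rewrite ImM.
Qed.

Lemma cintegrableD F G : cintegrable F -> cintegrable G ->
  cintegrable (fun x => F x + G x).
Proof.
move=> [rF iF] [rG iG]; split.
  by apply: eq_integrable (integrableD _ rF rG) => // x _ /=; rewrite ReD.
by apply: eq_integrable (integrableD _ iF iG) => // x _ /=; rewrite ImD.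
Qed.

Lemma cintegrableZ (k : R[i]) F : cintegrable F -> cintegrable (fun x => k * F x).
Proof.
move=> [rF iF]; split.
  apply: eq_integrable (integrableB _ (integrableZl _ (complex.Re k) rF)
    (integrableZl _ (complex.Im k) iF)) => // x _ /=.
  by rewrite ReM.
apply: eq_integrable (integrableD _ (integrableZl _ (complex.Re k) iF)
  (integrableZl _ (complex.Im k) rF)) => // x _ /=.
by rewrite ImM.
Qed.

Lemma cintegral_conj F : cintegrable F ->
  cintegral A (fun x => (F x)^*) = (cintegral A F)^*.
Proof.
move=> [rF iF]; apply: complex_eq; rewrite ?Re_conj ?Im_conj /=.
  by apply: eq_Rintegral => x _; rewrite Re_conj.
rewrite -mulN1r -RintegralZl//; apply: eq_Rintegral => x _.
by rewrite Im_conj mulN1r.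
Qed.

Definition ccontinuous F :=
  continuous (fun x => complex.Re (F x)) /\ continuous (fun x => complex.Im (F x)).

Lemma ccontinuousD F G : ccontinuous F -> ccontinuous G ->
  ccontinuous (fun x => F x + G x).
Proof.
move=> [rF iF] [rG iG]; split => x.
  by under eq_fun do rewrite ReD; apply: cvgD; [exact: rF|exact: rG].
by under eq_fun do rewrite ImD; apply: cvgD; [exact: iF|exact: iG].
Qed.

Lemma ccontinuousM F G : ccontinuous F -> ccontinuous G ->
  ccontinuous (fun x => F x * G x).
Proof.
move=> [rF iF] [rG iG]; split => x.
  under eq_fun do rewrite ReM.
  by apply: cvgB; apply: cvgM; [exact: rF|exact: rG|exact: iF|exact: iG].
under eq_fun do rewrite ImM.
by apply: cvgD; apply: cvgM; [exact: rF|exact: iG|exact: iF|exact: rG].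
Qed.

Lemma ccontinuous_conj F : ccontinuous F -> ccontinuous (fun x => (F x)^*).
Proof.
move=> [rF iF]; split => x.
  by under eq_fun do rewrite Re_conj; exact: rF.
by under eq_fun do rewrite Im_conj; apply: cvgN; exact: iF.
Qed.

Lemma ccontinuous_cst (c : R[i]) : ccontinuous (fun=> c).
Proof. by split => x; exact: cvg_cst. Qed.

Lemma ccontinuous_expi : ccontinuous (@expi R).
Proof. by split => x; [exact: continuous_cos|exact: continuous_sin]. Qed.

Lemma ccontinuous_expi_scale (c : R) : ccontinuous (fun x => expi (c * x)).
Proof.
have cc : continuous (fun x : R => c * x).
  by move=> x; apply: cvgM; [exact: cvg_cst|exact: cvg_id].
by split => x /=; apply: continuous_comp; [exact: cc|exact: continuous_cos
  |exact: cc|exact: continuous_sin].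
Qed.

Lemma ccontinuous_horner (p : {poly R[i]}) : ccontinuous (fun x => p.[expi x]).
Proof.
elim/poly_ind: p => [|p c IH].
  by under eq_fun do rewrite horner0; exact: ccontinuous_cst.
under eq_fun do rewrite hornerMXaddC.
apply: ccontinuousD; last exact: ccontinuous_cst.
by apply: ccontinuousM => //; exact: ccontinuous_expi.
Qed.

Lemma expiD (x y : R) : expi (x + y) = expi x * expi y.
Proof. by apply: complex_eq; rewrite ?ReM ?ImM /= ?cosD ?sinD// addrC. Qed.

Lemma expi_conj (x : R) : (expi x)^* = expi (- x).
Proof. by apply: complex_eq; rewrite ?Re_conj ?Im_conj /= ?cosN ?sinN. Qed.

Lemma expi0 : expi 0 = 1 :> R[i].
Proof. by rewrite /expi cos0 sin0. Qed.

Lemma expi_norm (x : R) : expi x * (expi x)^* = 1.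
Proof. by rewrite expi_conj -expiD subrr expi0. Qed.

Lemma expiX (x : R) n : expi x ^+ n = expi (n%:R * x).
Proof.
elim: n => [|n IH]; first by rewrite mul0r expi0.
by rewrite exprS IH -expiD -natr1 mulrDl mul1r addrC.
Qed.

End ComplexValued.

(** * The form on the circle *)

Section CircleForm.
Variables (R : realType) (t eta lambda : R).
Hypothesis lambda_gt : - (1 / 2) < lambda.
Notation mu := (@lebesgue_measure R).
Local Notation w := (weight t eta lambda).
Local Notation I := (`[0, (2 * pi)]%classic : set R).
Local Notation D p q := (circle_dot w (horner p) (horner q)).

Lemma cintegrable_weight (h : R -> R[i]) : ccontinuous h ->
  cintegrable `[0, (2 * pi)] (fun x => h x * (w x)%:C).
Proof.
move=> [rh ih]; split.
  apply: eq_integrable (integrable_continuousM t eta lambda_gt rh) => // x _ /=.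
  by rewrite ReM /= mulr0 subr0.
apply: eq_integrable (integrable_continuousM t eta lambda_gt ih) => // x _ /=.
by rewrite ImM /= mulr0 add0r.
Qed.

Lemma circle_integrable (p q : {poly R[i]}) :
  cintegrable `[0, (2 * pi)] (fun x => p.[expi x] * (q.[expi x])^* * (w x)%:C).
Proof.
apply: cintegrable_weight; apply: ccontinuousM; first exact: ccontinuous_horner.
by apply: ccontinuous_conj; exact: ccontinuous_horner.
Qed.

Lemma circle_dot_linear a p q r : D (a *: p + q) r = a * D p r + D q r.
Proof.
rewrite /circle_dot -cintegralZ; last exact: circle_integrable.
rewrite -cintegralD; last exact: circle_integrable.
- by apply: eq_cintegral => x _; rewrite hornerD hornerZ; ring.
- rewrite (_ : (fun x => _) = (fun x => (a *: p).[expi x] * (r.[expi x])^* * (w x)%:C)).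
    exact: circle_integrable.
  by apply/funext => x; rewrite hornerZ; ring.
Qed.

Lemma circle_dot_conj p q : D q p = (D p q)^*.
Proof.
rewrite /circle_dot -cintegral_conj; last exact: circle_integrable.
have cw x : ((w x)%:C)^* = (w x)%:C.
  by apply: complex_eq; rewrite ?Re_conj ?Im_conj /= ?oppr0.
have cM (a b : R[i]) : (a * b)^* = a^* * b^* by rewrite rmorphM.
by apply: eq_cintegral => x _; rewrite !cM conjCK cw [_ * q.[_]]mulrC.
Qed.

Lemma circle_dot_shift p q : D ('X * p) ('X * q) = D p q.
Proof.
apply: eq_cintegral => x _; rewrite !hornerM !hornerX rmorphM /=.
by rewrite mulrACA expi_norm mul1r.
Qed.

(** The integrand, [|p|^2 w] on the circle, is nonnegative with zero integral, so it vanishes almost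
    everywhere. As [w] is positive inside the interval and a nonzero [p] has finitely many roots,
    []0, pi[] would be a null set. *)
Lemma circle_dot_definite p : D p p = 0 -> p = 0.
Proof.
move=> Dp0; apply/eqP; apply: contraT => p0.
pose f (x : R) := complex.Re (p.[expi x] * (p.[expi x])^* * (w x)%:C).
have fi : mu.-integrable I (EFin \o f) := (circle_integrable p p).1.
have fE x : f x = (complex.Re p.[expi x] ^+ 2 + complex.Im p.[expi x] ^+ 2) * w x.
  by rewrite /f !ReM !Re_conj !Im_conj /=; ring.
have f0 x : 0 <= f x by rewrite fE mulr_ge0 ?weight_ge0// addr_ge0 ?sqr_ge0.
have int0 : (\int[mu]_(x in I) `|(EFin \o f) x| = 0)%E.
  have e : \int[mu]_(x in I) f x = 0 by have := congr1 (@complex.Re R) Dp0.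
  move: (congr1 (@EFin R) e).
  rewrite /Rintegral fineK; last exact: integrable_fin_num.
  by move=> h; rewrite -[RHS]h; apply: eq_integral => x _; rewrite /= ger0_norm.
have /integrableP[mf _] := fi.
have [N [mN N0 subN]] := (ae_eq_integral_abs mu (measurable_itv _) mf).1 int0.
have [rs pE] := closed_field_poly_normal p.
(* On []0, pi[] the angle is the arccosine of the real part of [e^(ix)], so [Z] contains every angle
   there at which [p] vanishes. *)
pose Z : set R := [set` [seq acos (complex.Re r) | r <- rs]].
have cZ : countable Z by apply: finite_set_countable; exact: finite_seq.
have Z0 : mu Z = 0 by exact: countable_lebesgue_measure0.
have mZ : measurable Z.
  by apply: countable_measurable cZ => z; exact: measurable_set1.
have sub : `]0, pi[ `<=` N `|` Z.
  move=> x /= x0p; have := x0p; rewrite in_itv /= => /andP[x0 xp].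
  have [px|px] := eqVneq p.[expi x] 0.
    right; apply/mapP; exists (expi x); last by rewrite /= cosK// in_itv /= !ltW.
    have : root p (expi x) by apply/eqP.
    by rewrite pE rootZ ?lead_coef_eq0// root_prod_XsubC.
  left; apply: subN => /= /(_ _).
  have x2 : x < 2 * pi by rewrite (lt_le_trans xp)// ler_peMl ?pi_ge0// ler1n.
  have xI : I x by rewrite /= in_itv /= !ltW.
  have wx : 0 < w x by apply: weight_gt0; rewrite in_itv /= x0.
  move=> /(_ xI) [] /eqP; rewrite fE mulf_eq0 (gt_eqF wx) orbF.
  rewrite paddr_eq0 ?sqr_ge0// !sqrf_eq0 => /andP[/eqP r0 /eqP i0].
  by move/eqP: px; apply; exact: complex_eq.
have : (mu `]0%R, pi[%classic <= mu N + mu Z)%E.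
  apply: le_trans (measureU2 _ mN mZ); apply: le_measure => //; rewrite inE.
    exact: measurable_itv.
  exact: measurableU.
rewrite N0 Z0 adde0 lebesgue_measure_itv /= lte_fin pi_gt0 oppr0 adde0.
by rewrite lee_fin leNgt pi_gt0.
Qed.

(** * The Pearson equation for moments and for polynomials *)

Definition trig_moment (k : R) : R[i] :=
  cintegral I (fun x => expi (k * x) * (w x)%:C).

Lemma circle_dot_monomial m n : D 'X^m 'X^n = trig_moment (m%:R - n%:R).
Proof.
apply: eq_cintegral => x _; rewrite !hornerXn !expiX expi_conj -expiD.
by congr (expi _ * _); ring.
Qed.

Lemma trig_moment_recurrence (k : R) :
  (k%:C + 1 + (lambda +i* eta)) * trig_moment (k + 1)
  + ((lambda +i* eta)^* - k%:C) * trig_moment k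
  + t%:C / 2 * (trig_moment (k + 2) - trig_moment (k + 1) - trig_moment k
                + trig_moment (k - 1)) = 0.
Proof.
(* As [z - 1 = 2 i sin (x / 2) e^(i x / 2)], the function [(z - 1) z^k w] is, up to [2 i],
   [e^(i (k + 1/2) x) sin (x / 2) w]. *)
pose m : R := k + 1 / 2.
pose u (x : R) := cos (m * x); pose v (x : R) := sin (m * x).
pose u' (x : R) := - m * sin (m * x); pose v' (x : R) := m * cos (m * x).
pose A (x : R) := (lambda + 1 / 2) * cos (x / 2) - (t * sin x + eta) * sin (x / 2).
pose h (z z' : R -> R) (x : R) := z' x * sin (x / 2) + z x * A x.
have dmx (x : R) : is_derive x 1 (fun x : R => m * x) m.
  by apply: is_derive_eq; rewrite /GRing.scale /= mulr1.
have hu : \int[mu]_(x in `[0, (2 * pi)]) (h u u' x * w x) = 0.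
  apply: weight_Pearson => // x; last first.
    apply: cvgM; first exact: cvg_cst.
    apply: continuous_comp; last exact: continuous_sin.
    exact: derive_continuous_at (dmx x).
  by rewrite /u /u'; apply: is_derive_eq; rewrite /GRing.scale /=; ring.
have hv : \int[mu]_(x in `[0, (2 * pi)]) (h v v' x * w x) = 0.
  apply: weight_Pearson => // x; last first.
    apply: cvgM; first exact: cvg_cst.
    apply: continuous_comp; last exact: continuous_cos.
    exact: derive_continuous_at (dmx x).
  by rewrite /v /v'; apply: is_derive_eq; rewrite /GRing.scale /=; ring.
have H0 : cintegral I (fun x => (h u u' x +i* h v v' x) * (w x)%:C) = 0.
  transitivity ((\int[mu]_(x in I) (h u u' x * w x)) +i* (\int[mu]_(x in I) (h v v' x * w x))).
    congr (_ +i* _); apply: eq_Rintegral => x _; last by rewrite ImM /= mulr0 add0r.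
    by rewrite ReM /= mulr0 subr0.
  by rewrite hu hv.
have TE : t%:C / 2 = (t / 2)%:C by rewrite rmorphM /= fmorphV rmorph_nat.
pose b : R[i] := lambda +i* eta.
pose T : R[i] := (t / 2)%:C.
(* With [q = e^(ix/2)], both sides share the factor [e^(ikx) q]; what remains is the identity [K]
   between Laurent polynomials in [q]. *)
have pointwise x : 2 * (h u u' x +i* h v v' x) =
    (k%:C + 1 + b - T) * expi ((k + 1) * x) + ((b^* - k%:C - T) * expi (k * x)
    + (T * expi ((k + 2) * x) + T * expi ((k - 1) * x))).
  pose q := expi (x / 2); pose qc := expi (- (x / 2)).
  have qqc : q * qc = 1 by rewrite -expiD subrr expi0.
  have -> : (k + 1) * x = k * x + (x / 2 + x / 2) by field.
  have -> : (k + 2) * x = k * x + (x / 2 + x / 2 + (x / 2 + x / 2)) by field.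
  have -> : (k - 1) * x = k * x + (- (x / 2) + - (x / 2)) by field.
  have -> : h u u' x +i* h v v' x = expi (m * x) * (A x +i* (m * sin (x / 2))).
    by apply: complex_eq; rewrite ?ReM ?ImM /= /h /u /u' /v /v'; ring.
  have -> : m * x = k * x + x / 2 by rewrite /m; field.
  rewrite !expiD -/q -/qc.
  have K : 2 * (A x +i* (m * sin (x / 2))) = (k%:C + 1 + b) * q + (b^* - k%:C) * qc
      + T * (q * q * q - q - qc + qc * qc * qc).
    have c2 : cos (x / 2) ^+ 2 = 1 - sin (x / 2) ^+ 2 by rewrite cos2sin2.
    have sx : sin x = 2 * (sin (x / 2) * cos (x / 2)).
      have e : x / 2 + x / 2 = x by field.
      by have := sinD (x / 2) (x / 2); rewrite e => ->; ring.
    apply: complex_eq; rewrite !(ReM, ImM, ReD, ImD, Re_conj, Im_conj, ReN, ImN) /=;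
      rewrite !(cosN, sinN).
      apply: subr0_eq; rewrite /A sx.
      (* The real parts differ by a multiple of the Pythagorean identity. *)
      transitivity (- t * cos (x / 2) * (cos (x / 2) ^+ 2 - (1 - sin (x / 2) ^+ 2))).
        by field.
      by rewrite c2 subrr mulr0.
    by rewrite /m; field.
  transitivity (expi (k * x) * q * (2 * (A x +i* (m * sin (x / 2))))); first by ring.
  have q0 : q != 0 by apply/eqP => q0; move/eqP: qqc; rewrite q0 mul0r eq_sym oner_eq0.
  rewrite K (_ : qc = q^-1); last by apply: (mulfI q0); rewrite qqc mulfV.
  by field.
rewrite TE -/T -/b.
transitivity ((k%:C + 1 + b - T) * trig_moment (k + 1) + ((b^* - k%:C - T) * trig_moment k
    + (T * trig_moment (k + 2) + T * trig_moment (k - 1)))); first by ring.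
have Ii (c : R) : cintegrable `[0, (2 * pi)] (fun x => expi (c * x) * (w x)%:C).
  by apply: cintegrable_weight; exact: ccontinuous_expi_scale.
have Zi (d : R[i]) (c : R) : cintegrable `[0, (2 * pi)] (fun x => d * (expi (c * x) * (w x)%:C)).
  exact: cintegrableZ.
rewrite /trig_moment -!cintegralZ// -!cintegralD//; try by do ?apply: cintegrableD.
set S := cintegral _ _.
have : 2^-1 * S = 0.
  rewrite -H0 /S -cintegralZ; last by do ?apply: cintegrableD.
  by apply: eq_cintegral => x _; rewrite -[in RHS](mulKf (_ : 2 != 0) (h u u' x +i* h v v' x))
    ?pnatr_eq0// pointwise; ring.
by move=> /eqP; rewrite mulf_eq0 invr_eq0 pnatr_eq0 => /eqP.
Qed.

Lemma linear_sum_coef (L : {poly R[i]} -> R[i]) p :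
  (forall a q r, L (a *: q + r) = a * L q + L r) ->
  L p = \sum_(i < size p) p`_i * L 'X^i.
Proof.
move=> Llin; have L0 : L 0 = 0.
  have := Llin 1 0 0; rewrite scaler0 addr0 mul1r => /eqP.
  by rewrite -subr_eq subrr eq_sym => /eqP.
have LD q r : L (q + r) = L q + L r by rewrite -[q in LHS]scale1r Llin mul1r.
have LZ a q : L (a *: q) = a * L q by rewrite -[in LHS](addr0 (a *: q)) Llin L0 addr0.
rewrite {1}(sum_coef (leqnn (size p))) (big_morph L LD L0).
by apply: eq_bigr => i _; exact: LZ.
Qed.

(** The difference [L] of the two sides is linear in [p], so monomials [X^i] suffice; there the
    equation is the moment recurrence at [k = i - j]. *)
Lemma circle_dot_Pearson p j : let b := lambda +i* eta in let T := t%:C / 2 in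
  D ('X * ('X - 1) * p^`()) 'X^j =
  - ((1 - j%:R + b - T) * D ('X * p) 'X^j + (j%:R + b^* - T) * D p 'X^j
     + T * D ('X^2 * p) 'X^j + T * D p 'X^(j.+1)).
Proof.
move=> b T; pose L q := D ('X * ('X - 1) * q^`()) 'X^j +
  ((1 - j%:R + b - T) * D ('X * q) 'X^j + (j%:R + b^* - T) * D q 'X^j
     + T * D ('X^2 * q) 'X^j + T * D q 'X^(j.+1)).
suff : L p = 0 by move=> /eqP; rewrite addr_eq0 => /eqP.
rewrite (@linear_sum_coef L); last first.
  move=> a q r; rewrite /L derivD derivZ !mulrDr -!scalerAr !circle_dot_linear; ring.
apply: big1 => i _; rewrite [L _](_ : _ = 0) ?mulr0// /L.
have -> : 'X * ('X - 1) * ('X^i)^`() = i%:R *: 'X^(i.+1) - i%:R *: 'X^i :> {poly R[i]}.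
  (* For [i = 0] the exponent [i - 1] is truncated, but the factor [i] makes both sides vanish. *)
  rewrite derivXn -mulr_natl -polyC_natr mul_polyC; case: (i : nat) => [|k]/=.
    by rewrite !scale0r mulr0 subrr.
  by rewrite -!mul_polyC !exprS; ring.
rewrite -scaleNr -exprS -exprD circle_dot_linear -[- i%:R *: _]addr0 circle_dot_linear.
have -> : D 0 'X^j = 0.
  have := circle_dot_linear (- 1) 0 0 'X^j; rewrite scaler0 addr0 mulN1r addrC subrr; exact.
rewrite !circle_dot_monomial; pose k : R := i%:R - j%:R.
have := trig_moment_recurrence k.
have -> : i.+1%:R - j%:R = k + 1 :> R by rewrite /k -natr1; ring.
have -> : (2 + i)%:R - j%:R = k + 2 :> R by rewrite /k natrD; ring.
have -> : i%:R - j.+1%:R = k - 1 :> R by rewrite /k -natr1; ring.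
rewrite -/k -/b -/T.
have -> : k%:C = i%:R - j%:R :> R[i] by rewrite /k rmorphB /= !rmorph_nat.
by move=> h; rewrite -[RHS]h; ring.
Qed.

End CircleForm.

(** * The differential equation for the given weight *)

Theorem theorem4p11 (R : realType) (t eta lambda : R)
    (hlambda : - (1 / 2) < lambda)
    (Phi : nat -> {poly R[i]})
    (hPhi : monic_OPUC (weight t eta lambda) Phi)
    (n : nat) (hn : (1 <= n)%N) (z : R[i]) :
  let b := lambda +i* eta in
  let alpha := verblunsky Phi in
  z ^+ 2 * (z - 1) * Vn t b alpha n z * ((Phi n)^`()^`()).[z]
  + p4 t b alpha n z * ((Phi n)^`()).[z]
  - p3 t b alpha n z * (Phi n).[z] = 0.
Proof.
move=> b alpha; have [size_monic ortho] := hPhi.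
have T_real : (t%:C / 2)^* = t%:C / 2 :> R[i].
  rewrite (_ : t%:C / 2 = (t / 2)%:C); last by rewrite rmorphM /= fmorphV rmorph_nat.
  by apply: complex_eq; rewrite ?Re_conj ?Im_conj /= ?oppr0.
have := differential_equation (circle_dot_linear t eta hlambda)
  (circle_dot_conj t eta hlambda) (circle_dot_shift t eta lambda)
  (@circle_dot_definite _ t eta lambda hlambda) (fun m => (size_monic m).1)
  (fun m => (size_monic m).2) ortho T_real
  (circle_dot_Pearson t eta hlambda) hn z.
have apE : alpha (n%:Z + 1) = - ((Phi n.+2).[0])^* by rewrite -PoszD addn1.
(* Since [n >= 1], the integer [n - 1] is nonnegative and falls in the [Posz] branch of
   [verblunsky]. *)
have amE : alpha (n%:Z - 1) = - ((Phi n.-1.+1).[0])^*.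
  by have -> : n%:Z - 1 = n.-1%:Z by lia.
have anE : alpha n = - ((Phi n.+1).[0])^* by [].
rewrite /= -apE -amE -anE -/b.
set T := t%:C / 2 in T_real *.
set s := s_coef _ _ _ _ _; set f := f_coef _ _ _ _ _ _; set g := g_coef _ _ _ _ _.
have sE : snn t b alpha n = s by [].
have fE : fn t b alpha n = f by rewrite /f /f_coef /fn sE normCK.
have gE : gamman t b alpha n = g by rewrite /gamman sE fE.
have VE : Vn t b alpha n z = - (T * (alpha n)^* * z ^+ 2 + f^* * z + T * (alpha (n%:Z - 1))^*).
  have -> : f^* = (1 - s^*) * (alpha n)^* + T * (1 - alpha n * (alpha n)^*)
      * (alpha (n%:Z + 1))^* by exact: conj_f_coef.
  by rewrite /Vn sE normCK -/T; ring.
have tE : t%:C = 2 * T by rewrite /T mulrC divfK// pnatr_eq0.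
move=> h; rewrite -[RHS]h /p4 /p3 gE VE /Un sE fE -/T tE; ring.
Qed.
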